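(* Let $n$ be a natural number and let $p,\varepsilon$ be real numbers with $0<p<1$ and $\frac1n<\varepsilon\le\min\{p,1-p\}$. Let $X_1,\dots,X_n$ be independent random variables with $\mathbf{Pr}(X_i=1)=p$ and $\mathbf{Pr}(X_i=0)=1-p$. Then $$\mathbf{Pr}\left(\left|\frac1n\sum_{i=1}^nX_i-p\right|>\varepsilon\right)\le\exp\left\{\varepsilon\cdot\varphi(n,\varepsilon)-\frac{2\varepsilon^2n}{1+\varepsilon^2}\right\},$$ where $$\varphi(n,\varepsilon):=\frac{\frac{n\varepsilon(1+\varepsilon^2)}{n\varepsilon-1}+\varepsilon\left(2+6\varepsilon+\frac{9}{2n}\right)}{(1+\varepsilon^2)\left(1+\varepsilon^2+\frac1n\left(1+3\varepsilon+\frac{9}{4n}\right)\right)}.$$ *)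

(* Defs.v *)
From HB Require Import structures.
From mathcomp Require Import all_boot all_order all_algebra.
From mathcomp Require Import all_classical all_reals all_analysis.

Set Implicit Arguments.
Unset Strict Implicit.
Unset Printing Implicit Defensive.

Import Order.TTheory GRing.Theory Num.Theory.
Import numFieldNormedType.Exports.

Local Open Scope classical_set_scope.
Local Open Scope ring_scope.

(* Mutual (not merely pairwise) independence: the product rule is required
   for every subfamily [J] and all measurable target sets. *)
Definition mutually_independent (d d' : measure_display)
    (T : measurableType d) (T' : measurableType d') (R : realType)
    (P : probability T R) (I : finType) (X : I -> {RV P >-> T'}) : Prop :=
  forall (J : {set I}) (B : I -> set T'),
    (forall i, i \in J -> measurable (B i)) ->
    P (\bigcap_(i in [set` J]) (X i @^-1` B i)) =
    (\prod_(i in J) P (X i @^-1` B i))%E.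

Definition phi (R : realType) (n : nat) (eps : R) : R :=
  (n%:R * eps * (1 + eps ^+ 2) / (n%:R * eps - 1)
     + eps * (2 + 6 * eps + 9 / (2 * n%:R)))
  / ((1 + eps ^+ 2)
     * (1 + eps ^+ 2 + n%:R^-1 * (1 + 3 * eps + 9 / (4 * n%:R)))).

(* Main.v *)
Require Import Defs.
From HB Require Import structures.
From mathcomp Require Import all_boot all_order all_algebra.
From mathcomp Require Import all_classical all_reals all_analysis.
From mathcomp Require Import unstable measurable_realfun.
From mathcomp Require Import ring lra zify.

Set Implicit Arguments.
Unset Strict Implicit.
Unset Printing Implicit Defensive.

Import Order.TTheory GRing.Theory Num.Theory.
Import numFieldNormedType.Exports.

Local Open Scope classical_set_scope.
Local Open Scope ring_scope.

(** The number of successes S = X_1 + ... + X_n has a binomial law b, and the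
    point is to bound the two tails of b together without the factor 2 that
    two separate exponential bounds would cost.

    This is possible because each tail is compared with the half of the
    distribution that contains it, and the two halves have total mass 1.
    Put c = n eps and let a be an integer in [np, np + 1].  If
    b (k + m) <= e * b k for all k >= a, where m is the number of steps from a
    to the first integer beyond np + c, then summing over k gives
    Pr(S > np + c) <= e * Pr(S >= a) ([binomial_upper_tail_le]).  Exchanging
    successes and failures gives Pr(S < np - c) <= e * Pr(S < a) with the same
    e, hence Pr(|S - np| > c) <= e ([binomial_two_tails_le]).

    The factor e comes from consecutive ratios.  With y = k - np >= 0 and
    q = 1 - p,
      b (k + 1) / b k = (nq - y) / (nq) * (np) / (np + y + 1),
    and both fractions are estimated by A / B <= exp (- 2 (B - A) / (A + B)),
    the comparison of the logarithmic and arithmetic means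
    ([le_expR_log_mean]).  The two exponents add up to at least
    2 (4y + 1) / (2n + 1), a quantity free of p, because their denominators
    2nq - y and 2np + y + 1 have the sum 2n + 1 ([weighted_sum_le]).
    Multiplying the ratios along m steps yields
      e = exp (- 2 (2 c^2 - c - 1) / (2n + 1)).

    Finally, the bound of the theorem simplifies: with
    D = 1 + 1/n + (eps + 3/(2n))^2, which is the second factor in the
    denominator of phi, its exponent equals
      - (2 c^2 - c^2 / (c - 1)) / (n D) = - (2 c^2 - c - 1 - 1 / (c - 1)) / (n D),
    and D > 1 + 1/(2n), so that it exceeds the exponent of e
    ([tail_exponent_le_phi]). *)

(** * Elementary inequalities *)

(** In the equivalent form (1 - w) e^w <= (1 + w) e^(-w), the difference of the
    two sides vanishes at w = 0 and has the derivative - w (e^w - e^(-w)), which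
    is nonpositive. *)
Lemma oneB_le_expR (R : realType) (w : R) :
  0 <= w -> 1 - w <= (1 + w) * expR (- (2 * w)).
Proof.
move=> w0.
pose g (x : R) : R := (1 - x) * expR x - (1 + x) * expR (- x).
have dg (x : R) : is_derive x 1 g (- x * (expR x - expR (- x))).
  by rewrite /g; apply: is_derive_eq; rewrite /GRing.scale /=; ring.
have : g w <= g 0.
  apply: (@ler0_derive1_nincry _ g 0) => //.
  - move=> x; rewrite in_itv/= andbT => x0; rewrite derive1E derive_val.
    by rewrite mulNr oppr_le0 mulr_ge0 ?subr_ge0 ?ler_expR; lra.
  - by apply: derivable_within_continuous => x _; exact: ex_derive.
rewrite /g oppr0 expR0 !addr0 subrr subr_le0 => H.
rewrite (_ : - (2 * w) = - w + - w); last by ring.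
by rewrite expRD mulrA expRN -ler_pdivrMr ?invr_gt0 ?expR_gt0// invrK -expRN.
Qed.

(** The logarithmic mean (B - A) / (log B - log A) is at most the arithmetic
    mean (A + B) / 2.  With w = (B - A) / (A + B) the quotient A / B is
    (1 - w) / (1 + w). *)
Lemma le_expR_log_mean (R : realType) (A B : R) : 0 <= A <= B -> 0 < B ->
  A <= B * expR (- (2 * (B - A) / (A + B))).
Proof.
move=> /andP[A0 AB] B0.
have S0 : 0 < A + B by lra.
have w0 : 0 <= (B - A) / (A + B) by rewrite divr_ge0 ?subr_ge0// ltW.
have := oneB_le_expR w0; rewrite mulrA.
rewrite (_ : 1 - _ = A * (2 / (A + B))); last by field; rewrite gt_eqF.
rewrite (_ : 1 + _ = B * (2 / (A + B))); last by field; rewrite gt_eqF.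
by rewrite mulrAC ler_pM2r// divr_gt0.
Qed.

(** After clearing denominators the difference of the two sides is
    2 (y (al - be)^2 + be^2).  The lower bound depends on the denominators
    only through their sum, which is what removes [p] below. *)
Lemma weighted_sum_le (R : realFieldType) (y al be : R) :
  0 <= y -> 0 < al -> 0 < be ->
  2 * (4 * y + 1) / (al + be) <= 2 * y / be + 2 * (y + 1) / al.
Proof.
move=> y0 al0 be0; rewrite -subr_ge0.
have -> : 2 * y / be + 2 * (y + 1) / al - 2 * (4 * y + 1) / (al + be)
    = 2 * (y * (al - be) ^+ 2 + be ^+ 2) / (al * be * (al + be)).
  by field; rewrite !gt_eqF ?addr_gt0.
apply: divr_ge0.
  by rewrite mulr_ge0 ?ler0n// addr_ge0 ?sqr_ge0// mulr_ge0 ?sqr_ge0.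
by rewrite !mulr_ge0 ?addr_ge0 ?ltW.
Qed.

(** * Tails of the binomial distribution *)

(** The ratio of consecutive terms is (nq - y) / (nq) * (np) / (np + y + 1) with
    y = k - np.  Estimating each fraction by [le_expR_log_mean] gives the
    denominators 2nq - y and 2np + y + 1, whose sum is 2n + 1. *)
Lemma binomial_pmf_succ_le (R : realType) (n k : nat) (p : R) :
  0 < p < 1 -> n%:R * p <= k%:R ->
  binomial_pmf n p k.+1
  <= expR (- (2 * (4 * (k%:R - n%:R * p) + 1) / (2 * n%:R + 1)))
     * binomial_pmf n p k.
Proof.
move=> /andP[p0 p1] npk.
have p01 : 0 <= p <= 1 by rewrite !ltW.
have q0 : 0 < 1 - p by rewrite subr_gt0.
have [kn|nk] := ltnP k n; last first.
  rewrite [leLHS]/binomial_pmf bin_small ?ltnS// mulr0n.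
  by rewrite mulr_ge0 ?expR_ge0 ?binomial_pmf_ge0.
have n0 : 0 < n%:R :> R by rewrite ltr0n (leq_ltn_trans _ kn).
have kn' : k%:R + 1 <= n%:R :> R by rewrite natr1 ler_nat.
set y := k%:R - n%:R * p; have y0 : 0 <= y by rewrite subr_ge0.
have rec : k.+1%:R * (1 - p) * binomial_pmf n p k.+1
           = (n%:R - k%:R) * p * binomial_pmf n p k.
  have /(congr1 (fun i : nat => i%:R : R)) := mul_bin_left n k.
  rewrite !natrM natrB 1?ltnW// => H.
  rewrite /binomial_pmf /onem -[_ *+ 'C(n, k)]mulr_natr.
  rewrite -[_ *+ 'C(n, k.+1)]mulr_natr exprS.
  rewrite (_ : (n - k = (n - k.+1).+1)%N); last by rewrite -subSn// subSS.
  rewrite exprS.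
  transitivity (k.+1%:R * 'C(n, k.+1)%:R
    * (p * p ^+ k * (1 - p) ^+ (n - k.+1)) * (1 - p)); first ring.
  by rewrite H; ring.
have np0 : 0 < n%:R * p by rewrite mulr_gt0.
have nq0 : 0 < n%:R * (1 - p) by rewrite mulr_gt0.
have nqy : y + 1 <= n%:R * (1 - p) by rewrite /y; lra.
have lm1 : n%:R * (1 - p) - y
    <= n%:R * (1 - p) * expR (- (2 * y / (2 * (n%:R * (1 - p)) - y))).
  apply: le_trans (@le_expR_log_mean _ (n%:R * (1 - p) - y) _ _ nq0) _; first lra.
  by rewrite subKr [_ - y + _](_ : _ = 2 * (n%:R * (1 - p)) - y)//; ring.
have lm2 : n%:R * p
    <= (n%:R * p + y + 1) * expR (- (2 * (y + 1) / (2 * (n%:R * p) + y + 1))).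
  apply: le_trans (@le_expR_log_mean _ _ (n%:R * p + y + 1) _ _) _; [lra|lra|].
  rewrite (_ : n%:R * p + y + 1 - n%:R * p = y + 1); last ring.
  by rewrite (_ : n%:R * p + (n%:R * p + y + 1) = 2 * (n%:R * p) + y + 1)//; ring.
have k1q : 0 < k.+1%:R * (1 - p) by rewrite mulr_gt0.
rewrite -(ler_pM2l k1q) rec mulrA ler_wpM2r ?binomial_pmf_ge0//.
rewrite -(ler_pM2l n0).
apply: (@le_trans _ _ ((n%:R * (1 - p) * expR (- (2 * y / (2 * (n%:R * (1 - p)) - y))))
   * ((n%:R * p + y + 1) * expR (- (2 * (y + 1) / (2 * (n%:R * p) + y + 1)))))).
  apply: le_trans (ler_pM _ _ lm1 lm2); [|lra|lra].
  by rewrite le_eqVlt; apply/orP; left; apply/eqP; rewrite /y; ring.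
rewrite mulrACA -expRD (_ : n%:R * p + y + 1 = k.+1%:R); last first.
  by rewrite /y -natr1; ring.
rewrite [leRHS]mulrA [n%:R * (_ * (1 - p))]mulrA [n%:R * k.+1%:R * _]mulrAC.
rewrite ler_wpM2l ?ler_expR//.
  by rewrite !mulr_ge0// ltW.
set al := 2 * (n%:R * p) + y + 1; set be := 2 * (n%:R * (1 - p)) - y.
have al0 : 0 < al by rewrite /al; lra.
have be0 : 0 < be by rewrite /be; lra.
rewrite -opprD lerN2 (_ : 2 * n%:R + 1 = al + be); last by rewrite /al/be; ring.
by apply: weighted_sum_le.
Qed.

(** With y = a - np, the numerator 4 m y + 2 m^2 - m is the sum of
    4 (y + j) + 1 over j < m. *)
Lemma binomial_pmf_shift_le (R : realType) (n a k m : nat) (p : R) :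
  0 < p < 1 -> n%:R * p <= a%:R -> (a <= k)%N ->
  binomial_pmf n p (k + m)
  <= expR (- (2 * (4 * m%:R * (a%:R - n%:R * p) + 2 * m%:R ^+ 2 - m%:R)
              / (2 * n%:R + 1)))
     * binomial_pmf n p k.
Proof.
move=> p01 npa ak; have ak' : a%:R <= k%:R :> R by rewrite ler_nat.
elim: m => [|m IH].
  by rewrite addn0 !(mulr0, mul0r, expr0n, subr0, addr0, oppr0, expR0, mul1r).
rewrite addnS; apply: le_trans (binomial_pmf_succ_le p01 _) _.
  by rewrite (le_trans npa)// ler_nat (leq_trans ak)// leq_addr.
apply: le_trans (ler_wpM2l (expR_ge0 _) IH) _.
rewrite mulrA -expRD ler_wpM2r ?binomial_pmf_ge0 ?ler_expR//.
  by case/andP: p01 => *; rewrite !ltW.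
rewrite -opprD lerN2 -mulrDl ler_pM2r ?invr_gt0; last first.
  by rewrite ltr_pwDr// mulr_ge0.
rewrite -mulrDr ler_pM2l// natrD -natr1.
nra.
Qed.

(** The tail beyond n p + c is a translate of part of the tail from [a] on,
    and a translation by m multiplies each term by at most the stated factor. *)
Lemma binomial_upper_tail_le (R : realType) (n a : nat) (p c : R) :
  0 < p < 1 -> 1 < c -> n%:R * p <= a%:R <= n%:R * p + 1 ->
  \sum_(k < n.+1 | n%:R * p + c < k%:R) binomial_pmf n p k
  <= expR (- (2 * (2 * c ^+ 2 - c - 1) / (2 * n%:R + 1))) *
     \sum_(k < n.+1 | (a <= k)%N) binomial_pmf n p k.
Proof.
move=> p01 c1 /andP[npa anp1].
have p01' : 0 <= p <= 1 by case/andP: p01 => *; rewrite !ltW.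
have np0 : 0 <= n%:R * p by rewrite mulr_ge0//; case/andP: p01'.
have npc0 : 0 <= n%:R * p + c by lra.
set K := (Num.truncn (n%:R * p + c)).+1.
have Kgt : n%:R * p + c < K%:R by case/andP: (truncn_itv npc0).
have aK : (a <= K)%N by rewrite -(ler_nat R); lra.
have mK : (K - a)%:R = K%:R - a%:R :> R by rewrite natrB.
rewrite (eq_bigl (fun k : 'I_n.+1 => xpredT (k : nat) && (K <= k)%N)); last first.
  by move=> k /=; rewrite truncn_lt_nat.
rewrite -(big_geq_mkord K n.+1 xpredT) -(subnKC aK) big_addn.
rewrite -(big_geq_mkord a n.+1 xpredT).
apply: (@le_trans _ _ (expR (- (2 * (2 * c ^+ 2 - c - 1) / (2 * n%:R + 1))) *
   \sum_(a <= i < n.+1 - (K - a)) binomial_pmf n p i)).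
  rewrite mulr_sumr; apply: ler_sum_nat => k /andP[ak _].
  apply: le_trans (binomial_pmf_shift_le _ p01 npa ak) _.
  rewrite ler_wpM2r ?binomial_pmf_ge0// ler_expR lerN2.
  rewrite ler_pM2r ?invr_gt0; last by rewrite ltr_pwDr// mulr_ge0.
  rewrite ler_pM2l// mK.
  set y := a%:R - n%:R * p.
  set M := K%:R - n%:R * p.
  have -> : K%:R - a%:R = M - y by rewrite /M /y; ring.
  have M0 : c < M by rewrite /M; lra.
  have y0 : 0 <= y <= 1 by rewrite /y; apply/andP; lra.
  (* In terms of M, the sum of the m exponents is 2 M^2 - M + y - 2 y^2.  It
     increases with M >= c, and y - 2 y^2 + 1 = (1 - y) (1 + 2 y) >= 0. *)
  nra.
rewrite ler_wpM2l ?expR_ge0//.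
have b0 (i : nat) : xpredT i -> 0 <= binomial_pmf n p i.
  by move=> _; exact: binomial_pmf_ge0.
have [aN|Na] := leqP a (n.+1 - (K - a))%N; last first.
  by rewrite (big_geq (ltnW Na)) sumr_ge0.
by rewrite [leRHS](big_cat_nat aN (leq_subr _ _))/= lerDl sumr_ge0.
Qed.

Lemma binomial_pmf_rev (R : realType) (n k : nat) (p : R) : (k <= n)%N ->
  binomial_pmf n (1 - p) (n - k) = binomial_pmf n p k.
Proof.
by move=> kn; rewrite /binomial_pmf /onem bin_sub// subKn// subKr mulrC.
Qed.

Lemma sum_binomial_pmf (R : realType) (n : nat) (p : R) :
  \sum_(k < n.+1) binomial_pmf n p k = 1.
Proof.
rewrite -(expr1n R n) -[X in X ^+ n](subrK p) exprDn.
by apply: eq_bigr => k _; rewrite mulrC.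
Qed.

(** Exchanging successes and failures turns lower tails into upper tails. *)
Lemma sum_binomial_pmf_rev (R : realType) (n : nat) (p : R) (Q Q' : pred nat) :
  (forall k, (k <= n)%N -> Q' (n - k)%N = Q k) ->
  \sum_(k < n.+1 | Q k) binomial_pmf n p k
  = \sum_(k < n.+1 | Q' k) binomial_pmf n (1 - p) k.
Proof.
move=> QQ'; rewrite [RHS](reindex_inj rev_ord_inj)/=.
apply: eq_big => k; rewrite subSS; first by rewrite QQ'// -ltnS.
by move=> _; rewrite binomial_pmf_rev// -ltnS.
Qed.

(** The upper tail is charged to the values k >= a and the lower tail to the
    values k < a, so the two contributions share the total mass 1. *)
Lemma binomial_two_tails_le (R : realType) (n : nat) (p c : R) :
  (0 < n)%N -> 0 < p < 1 -> 1 < c ->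
  \sum_(k < n.+1 | c < `|k%:R - n%:R * p|) binomial_pmf n p k
  <= expR (- (2 * (2 * c ^+ 2 - c - 1) / (2 * n%:R + 1))).
Proof.
move=> n0 p01 c1; have /andP[p0 p1] := p01.
have n0' : 0 < n%:R :> R by rewrite ltr0n.
have np0 : 0 <= n%:R * p by rewrite mulr_ge0// ltW.
have npn : n%:R * p < n%:R by rewrite gtr_pMr.
set a := (Num.truncn (n%:R * p)).+1.
have /andP[anp npa] := truncn_itv np0.
have npa1 : n%:R * p <= a%:R <= n%:R * p + 1.
  by rewrite ltW//= /a -natr1 lerD2r.
have an : (a <= n)%N by rewrite /a truncn_lt_nat.
rewrite (bigID (fun k : 'I_n.+1 => n%:R * p + c < k%:R))/=.
rewrite (eq_bigl (fun k : 'I_n.+1 => n%:R * p + c < k%:R)); last first.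
  move=> k /=; rewrite ltr_normr; apply/andP/idP => [[]//|?]; split => //.
  by apply/orP; left; lra.
rewrite [X in _ + X](eq_bigl (fun k : 'I_n.+1 => k%:R < n%:R * p - c)); last first.
  move=> k /=; rewrite ltr_normr -leNgt; apply/andP/idP; last first.
    by split; [apply/orP; right|]; lra.
  by case=> /orP[]; lra.
rewrite [X in _ + X](@sum_binomial_pmf_rev _ _ _ (fun k => k%:R < n%:R * p - c)
  (fun k => n%:R * (1 - p) + c < k%:R)); last first.
  by move=> k kn /=; rewrite natrB//; apply/idP/idP; lra.
rewrite -[leRHS]mulr1 -[X in _ <= _ * X](sum_binomial_pmf n p).
rewrite [X in _ <= _ * X](bigID (fun k : 'I_n.+1 => (a <= k)%N))/= [leRHS]mulrDr.
apply: lerD; first exact: binomial_upper_tail_le.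
(* For the reflected distribution, of mean n - np, the threshold n + 1 - a
   again exceeds the mean by at most 1. *)
rewrite (@sum_binomial_pmf_rev _ _ _ (fun k => ~~ (a <= k)%N)
  (fun k => (n.+1 - a <= k)%N)); last first.
  by move=> k kn /=; rewrite leq_subLR addnBA// leq_subRL ?ltnNge//; lia.
apply: binomial_upper_tail_le => //; first by rewrite subr_gt0 p1/=; lra.
rewrite natrB; last exact: leqW.
by rewrite -natr1; apply/andP; lra.
Qed.

(** * The law of a sum of independent Bernoulli variables *)

(** The atoms on which all the [X i] are prescribed, with values 0 and 1: by
    independence, each has a product probability. *)
Lemma bernoulli_atom (R : realType) (d : measure_display) (T : measurableType d)
    (P : probability T R) (n : nat) (p : R)
    (X : 'I_n -> {RV P >-> R}) (X_indep : mutually_independent X)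
    (X1 : forall i, P (X i @^-1` [set 1]) = p%:E)
    (X0 : forall i, P (X i @^-1` [set 0]) = (1 - p)%:E) (J : {set 'I_n}) :
  P [set t | forall i, X i t = (i \in J)%:R]
  = (p ^+ #|J| * (1 - p) ^+ (n - #|J|))%:E.
Proof.
have -> : [set t | forall i, X i t = (i \in J)%:R]
  = \bigcap_(i in [set` [set: 'I_n]%SET]) X i @^-1` [set (i \in J)%:R].
  apply/seteqP; split => t /= h i; first by move=> _; exact: h.
  by apply: h => /=; rewrite inE.
rewrite X_indep//.
rewrite (eq_bigl xpredT); last by move=> i; rewrite inE.
rewrite (eq_bigr (fun i => (if i \in J then p else 1 - p)%:E)); last first.
  by move=> i _; case: ifP => _; [exact: X1|exact: X0].
rewrite prodEFin; congr (_%:E).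
rewrite (bigID (mem J))/=; congr (_ * _).
  by rewrite (eq_bigr (fun=> p)) ?prodr_const// => i ->.
rewrite (eq_bigr (fun=> 1 - p)) => [|i /negbTE ->//].
rewrite prodr_const; congr (_ ^+ _).
have /(congr1 (subn^~ #|J|)) := cardC (mem J).
by rewrite addKn card_ord => <-.
Qed.

Lemma sum_bernoulli_weights (R : realType) (n : nat) (p : R) (Q : pred nat) :
  \sum_(J : {set 'I_n} | Q #|J|) p ^+ #|J| * (1 - p) ^+ (n - #|J|) =
  \sum_(k < n.+1 | Q k) binomial_pmf n p k.
Proof.
have h (J : {set 'I_n}) : (#|J| < n.+1)%N.
  by rewrite ltnS -[leqRHS]card_ord max_card.
rewrite (partition_big (fun J : {set 'I_n} => Ordinal (h J))
  (fun k : 'I_n.+1 => Q k))//=.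
apply: eq_bigr => k Qk.
rewrite (eq_big (fun J => J \in [set J : {set 'I_n} | #|J| == k]%SET)
  (fun=> p ^+ k * (1 - p) ^+ (n - k))).
- by rewrite sumr_const card_draws card_ord.
- move=> J; rewrite inE -val_eqE /=; case: eqP => [->|_]; [by rewrite Qk|by rewrite andbF].
- by move=> J /andP[_ /eqP <-].
Qed.

(** The atoms indexed by the sets [J] with [Q #|J|] are disjoint and lie in the
    event.  They exhaust it only up to a null set, on which some [X i] takes a
    value other than 0 and 1; hence an inequality. *)
Lemma bernoulli_sum_law_ge (R : realType) (d : measure_display) (T : measurableType d)
    (P : probability T R) (n : nat) (p : R)
    (X : 'I_n -> {RV P >-> R}) (X_indep : mutually_independent X)
    (X1 : forall i, P (X i @^-1` [set 1]) = p%:E)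
    (X0 : forall i, P (X i @^-1` [set 0]) = (1 - p)%:E) (Q : set R) :
  measurable Q ->
  ((\sum_(k < n.+1 | `[< Q k%:R >]) binomial_pmf n p k)%:E
   <= P [set t | (Q (\sum_(i < n) X i t))%R])%E.
Proof.
move=> mQ.
pose A (J : {set 'I_n}) := [set t | forall i, X i t = (i \in J)%:R].
have AE J : A J
    = \bigcap_(i in [set` [set: 'I_n]%SET]) X i @^-1` [set (i \in J)%:R].
  apply/seteqP; split => t /= h i; first by move=> _; exact: h.
  by apply: h => /=; rewrite inE.
have mA J : measurable (A J).
  rewrite AE; apply: fin_bigcap_measurable; first exact: finite_finset.
  by move=> i _; rewrite -[_ @^-1` _]setTI; apply: measurable_funPT.
rewrite -(sum_bernoulli_weights n p (fun k => `[< Q k%:R >])) -sumEFin.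
under eq_bigr do rewrite -(bernoulli_atom X_indep X1 X0).
rewrite -big_filter.
rewrite fsbig_seq ?filter_uniq ?index_enum_uniq// -measure_fin_bigcup//.
- apply: le_measure; rewrite ?inE.
  + apply: fin_bigcup_measurable => [|J _]; last exact: mA.
    exact: finite_finset.
  + have mS : measurable_fun setT (fun t => \sum_(i < n) X i t).
      by apply: measurable_sum => i.
    by rewrite -[X in measurable X]setTI; exact: mS.
  + move=> t [J /=]; rewrite mem_filter => /andP[/asboolP QJ _] XJ.
    rewrite (eq_bigr _ (fun i _ => XJ i)) -natr_sum.
    rewrite (_ : (\sum_(i < n) (i \in J))%N = #|J|)//.
    by rewrite -sum1_card [RHS]big_mkcond; apply: eq_bigr => i _; case: (i \in J).
- move=> J J' _ _ [t [/= tJ tJ']]; apply/setP => i.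
  have := tJ i; rewrite tJ' => /eqP; rewrite eqr_nat.
  by case: (i \in J); case: (i \in J').
- by move=> J _; exact: mA.
Qed.

(** Both the event and its complement satisfy the lower bound, and the two
    lower bounds add up to 1; so they are equalities. *)
Lemma bernoulli_sum_law (R : realType) (d : measure_display)
    (T : measurableType d) (P : probability T R) (n : nat) (p : R)
    (X : 'I_n -> {RV P >-> R}) (X_indep : mutually_independent X)
    (X1 : forall i, P (X i @^-1` [set 1]) = p%:E)
    (X0 : forall i, P (X i @^-1` [set 0]) = (1 - p)%:E) (Q : set R) :
  measurable Q ->
  P [set t | (Q (\sum_(i < n) X i t))%R]
  = (\sum_(k < n.+1 | `[< Q k%:R >]) binomial_pmf n p k)%:E.
Proof.
move=> mQ; apply/eqP; rewrite eq_le; apply/andP; split; last first.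
  exact: bernoulli_sum_law_ge.
have mS : measurable_fun setT (fun t => \sum_(i < n) X i t).
  by apply: measurable_sum => i.
have mE : measurable [set t | (Q (\sum_(i < n) X i t))%R].
  by rewrite -[X in measurable X]setTI; exact: mS.
have := bernoulli_sum_law_ge X_indep X1 X0 (measurableC mQ).
rewrite (_ : [set t | _] = ~` [set t | (Q (\sum_(i < n) X i t))%R])//.
rewrite probability_setC// -(fineK (fin_num_measure P _ mE)) -EFinB !lee_fin.
have := sum_binomial_pmf n p.
rewrite (bigID (fun k : 'I_n.+1 => `[< Q k%:R >]))/=.
rewrite [X in _ + X = _](eq_bigl (fun k : 'I_n.+1 => `[< (~` Q) k%:R >])).
  by lra.
by move=> k; rewrite -asbool_neg.
Qed.

(** * The exponent of the bound *)

(** With c = n eps and D = (1 + eps^2) + E the second factor of the denominator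
    of phi, the second summand of the numerator contributes
    2 eps^2 n E / ((1 + eps^2) D) = 2 eps^2 n (1 / (1 + eps^2) - 1 / D) to
    eps phi; this turns the denominator 1 + eps^2 of the Gaussian term into D.
    The first summand contributes c^2 / (c - 1) / (n D). *)
Lemma tail_exponent_le_phi (R : realType) (n : nat) (eps : R) :
  (0 < n)%N -> n%:R^-1 < eps ->
  - (2 * (2 * (n%:R * eps) ^+ 2 - n%:R * eps - 1) / (2 * n%:R + 1))
  <= eps * phi n eps - 2 * eps ^+ 2 * n%:R / (1 + eps ^+ 2).
Proof.
rewrite /phi -(ltr0n R); move: n%:R => {}n n0 he.
have e0 : 0 < eps by apply: lt_trans he; rewrite invr_gt0.
set c := n * eps.
have c1 : 1 < c by rewrite /c -ltr_pdivrMl ?mulr1.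
set D := 1 + n^-1 + (eps + 3 / 2 * n^-1) ^+ 2.
have h0 : 0 < n^-1 by rewrite invr_gt0.
have D0 : 1 + n^-1 / 2 < D by rewrite /D; nra.
have -> : 1 + eps ^+ 2 + n^-1 * (1 + 3 * eps + 9 / (4 * n)) = D.
  by rewrite /D; field; rewrite gt_eqF.
have -> : eps * ((c * (1 + eps ^+ 2) / (c - 1)
     + eps * (2 + 6 * eps + 9 / (2 * n)))
  / ((1 + eps ^+ 2) * D)) - 2 * eps ^+ 2 * n / (1 + eps ^+ 2)
  = - ((2 * c ^+ 2 - c ^+ 2 / (c - 1)) / (n * D)).
  rewrite /D /c; field.
  rewrite !gt_eqF ?subr_gt0//; first by rewrite ltr_wpDr ?sqr_ge0.
  by rewrite ltr_wpDr ?sqr_ge0// !mulr_gt0// addr_gt0.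
have nD0 : 0 < n * D by rewrite mulr_gt0//; lra.
rewrite lerN2.
apply: (@le_trans _ _ ((2 * c ^+ 2 - c - 1) / (n * D))).
  rewrite ler_pM2r ?invr_gt0//.
  rewrite -subr_ge0 (_ : _ - _ = (c - 1)^-1); last by field; lra.
  by rewrite invr_ge0; lra.
rewrite [2 * (_ - _)]mulrC -mulrA ler_wpM2l//; first nra.
rewrite -[2 / _]invf_div lef_pV2 ?posrE ?divr_gt0//; [|lra].
have nh : n * n^-1 = 1 by rewrite mulfV// gt_eqF.
nra.
Qed.

Theorem theorem5 (R : realType) (d : measure_display) (T : measurableType d)
    (P : probability T R) (n : nat) (p eps : R)
    (X : 'I_n -> {RV P >-> R})
    (n_gt0 : (0 < n)%N)
    (p_gt0 : 0 < p) (p_lt1 : p < 1)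
    (eps_gt : n%:R^-1 < eps) (eps_le : eps <= Num.min p (1 - p))
    (X_indep : mutually_independent X)
    (X1 : forall i, P (X i @^-1` [set 1]) = p%:E)
    (X0 : forall i, P (X i @^-1` [set 0]) = (1 - p)%:E) :
  (P [set t | (eps < `| n%:R^-1 * (\sum_(i < n) X i t) - p |)%R]
   <= (expR (eps * phi n eps
             - 2 * eps ^+ 2 * n%:R / (1 + eps ^+ 2)))%:E)%E.
Proof.
have n0 : 0 < n%:R :> R by rewrite ltr0n.
have c1 : 1 < n%:R * eps by rewrite -ltr_pdivrMl ?mulr1.
pose Q := [set x : R | n%:R * eps < `|x - n%:R * p|].
have mQ : measurable Q.
  rewrite (_ : Q = (fun x => `|x - n%:R * p|) @^-1` `]n%:R * eps, +oo[%classic).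
    have mf : measurable_fun setT (fun x : R => `|x - n%:R * p|).
      by apply: measurableT_comp => //; exact: measurable_funB.
    by rewrite -[X in measurable X]setTI; exact: mf.
  by apply/seteqP; split => x /=; rewrite in_itv/= andbT.
have scaleE x : (n%:R * eps < `|x - n%:R * p|) = (eps < `|n%:R^-1 * x - p|).
  rewrite -[RHS](ltr_pM2l n0) -[X in X * `|_|](gtr0_norm n0) -normrM mulrBr.
  by rewrite mulVKf ?gt_eqF.
have -> : [set t | (eps < `| n%:R^-1 * (\sum_(i < n) X i t) - p |)%R]
    = [set t | (Q (\sum_(i < n) X i t))%R].
  by apply/seteqP; split => t; rewrite /Q /= scaleE.
rewrite (bernoulli_sum_law X_indep X1 X0 mQ) lee_fin.
rewrite (eq_bigl (fun k : 'I_n.+1 => n%:R * eps < `|k%:R - n%:R * p|)); last first.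
  by move=> k; rewrite asboolb.
apply: le_trans (binomial_two_tails_le n_gt0 _ c1) _; first by rewrite p_gt0.
by rewrite ler_expR; exact: tail_exponent_le_phi.
Qed.
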